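(* Let $0<\mu\le\lambda\le 1$ and $-1\le B<0$. Then for every $n\in\mathbb{N}$, $$\frac{s_n(v_\mu(0,B,z))}{v_\lambda(0,B,z)}\prec\frac{1}{v_\lambda(0,B,z)},\qquad z\in\mathbb{D},$$ where $v_\nu(0,B,z)=\dfrac{1}{(1+Bz)^{\nu}}$ for $\nu\in(0,1]$.
   Context: $\mathbb{D}=\{z\in\mathbb{C}:|z|<1\}$ and $\mathbb{N}=\{1,2,3,\dots\}$. Powers are principal branches (value $1$ at $z=0$). For $f(z)=\sum_{k=0}^\infty a_kz^k$ analytic in $\mathbb{D}$, the $n$-th partial sum is $s_n(f(z))=\sum_{k=0}^n a_kz^k$. For $f,g$ analytic in $\mathbb{D}$, $f\prec g$ ($f$ is subordinate to $g$) means there is an analytic $\omega:\mathbb{D}\to\mathbb{C}$ with $\omega(0)=0$ and $|\omega(z)|<1$ for all $z\in\mathbb{D}$ such that $f=g\circ\omega$. *)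

(* Defs.v *)
From Stdlib Require Import Reals Lra ClassicalEpsilon.
From Coquelicot Require Import Coquelicot.

Open Scope R_scope.

Definition unit_disc (z : C) : Prop := Cmod z < 1.

(* Complex differentiability: the scalar field of [ex_derive] is [C], not [R]. *)
Definition analytic_on_disc (f : C -> C) : Prop :=
  forall z : C, unit_disc z -> @ex_derive C_AbsRing C_NormedModule f z.

(* Principal argument, in (-PI, PI]; its value at 0 is irrelevant. *)
Definition Arg (w : C) : R :=
  if Rle_dec 0 (Im w) then acos (Re w / Cmod w) else - acos (Re w / Cmod w).

Definition Cexp (z : C) : C :=
  (exp (Re z) * cos (Im z), exp (Re z) * sin (Im z)).

Definition Clog (w : C) : C := (ln (Cmod w), Arg w).

(* Principal branch of w ^ nu, meaningful for w <> 0. *)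
Definition Cpowr (w : C) (nu : R) : C := Cexp (RtoC nu * Clog w)%C.

Definition v (nu B : R) (z : C) : C := (1 / Cpowr (1 + RtoC B * z) nu)%C.

Definition power_series_on_disc (f : C -> C) (a : nat -> C) : Prop :=
  forall z : C, unit_disc z -> @is_pseries C_AbsRing C_NormedModule a z (f z).

(* Well defined when f has a power series expansion on the disc, since the
   expansion is then unique: see [partial_sum_unique]. *)
Definition coefficients (f : C -> C) : nat -> C :=
  epsilon (inhabits (fun _ : nat => RtoC 0)) (power_series_on_disc f).

Definition partial_sum (n : nat) (f : C -> C) (z : C) : C :=
  sum_n (fun k => coefficients f k * z ^ k)%C n.

Definition subordinate (f g : C -> C) : Prop :=
  analytic_on_disc f /\ analytic_on_disc g /\
  exists omega : C -> C,
    analytic_on_disc omega /\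
    omega (RtoC 0) = RtoC 0 /\
    (forall z : C, unit_disc z -> Cmod (omega z) < 1) /\
    (forall z : C, unit_disc z -> f z = g (omega z)).

Lemma pow_n_RtoC (x : R) (k : nat) :
  @pow_n C_AbsRing (RtoC x) k = RtoC (x ^ k).
Proof.
induction k as [|k IH]; [reflexivity|].
change (Cmult (RtoC x) (@pow_n C_AbsRing (RtoC x) k) = RtoC (x * x ^ k)).
rewrite IH. symmetry. apply RtoC_mult.
Qed.

Lemma is_pseries_Re_Im (a : nat -> C) (x : R) (l : C) :
  @is_pseries C_AbsRing C_NormedModule a (RtoC x) l ->
  is_pseries (fun k => Re (a k)) x (Re l) /\
  is_pseries (fun k => Im (a k)) x (Im l).
Proof.
intros H.
assert (E : forall n : nat,
  sum_n (fun k => @scal C_AbsRing C_NormedModule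
    (@pow_n C_AbsRing (RtoC x) k) (a k)) n
  = (sum_n (fun k => scal (pow_n x k) (Re (a k))) n,
     sum_n (fun k => scal (pow_n x k) (Im (a k))) n)).
{ assert (T : forall k, @scal C_AbsRing C_NormedModule
    (@pow_n C_AbsRing (RtoC x) k) (a k)
    = (scal (pow_n x k) (Re (a k)), scal (pow_n x k) (Im (a k)))).
  { intros k. rewrite pow_n_RtoC.
    change (Cmult (RtoC (x ^ k)) (a k)
      = (x ^ k * Re (a k), x ^ k * Im (a k))).
    unfold Cmult, RtoC, Re, Im; simpl. f_equal; ring. }
  induction n as [|n IH].
  - rewrite 3!sum_O. apply T.
  - rewrite 3!sum_Sn. rewrite IH, T. reflexivity. }
unfold is_pseries, is_series in *.
assert (H' := filterlim_ext _ _ E H).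
split; intros P [e He].
- apply (H' (fun w : C => P (Re w))). exists e. intros y [Hy _]. apply He, Hy.
- apply (H' (fun w : C => P (Im w))). exists e. intros y [_ Hy]. apply He, Hy.
Qed.

Lemma real_coefficients_unique (a b : nat -> R) (f : R -> R) :
  (forall x, Rabs x < 1 -> is_pseries a x (f x)) ->
  (forall x, Rabs x < 1 -> is_pseries b x (f x)) ->
  forall k, a k = b k.
Proof.
assert (R0 : forall c : nat -> R,
  (forall x, Rabs x < 1 -> is_pseries c x (f x)) ->
  Rbar_lt 0 (CV_radius c)).
{ intros c Hc. assert (Hh : Rabs (1/2) < 1) by (apply Rabs_def1; lra).
  apply Rbar_lt_le_trans with (Rabs (1/2)); [simpl; rewrite Rabs_right; lra|].
  apply Rbar_not_lt_le. intros Hl.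
  apply (CV_disk_outside c (1/2) Hl).
  assert (Hs : ex_series (fun n => c n * (1/2) ^ n)).
  { exists (f (1/2)). eapply is_series_ext; [|exact (Hc _ Hh)].
    intros n. simpl. rewrite pow_n_pow. apply Rmult_comm. }
  exact (ex_series_lim_0 _ Hs). }
intros Ha Hb k. apply PSeries_ext_recip; [exact (R0 a Ha)|exact (R0 b Hb)|].
exists (mkposreal 1 Rlt_0_1). intros y Hy.
assert (Hy' : Rabs y < 1).
{ change (Rabs (y - 0) < 1) in Hy. now rewrite Rminus_0_r in Hy. }
rewrite (is_pseries_unique _ _ _ (Ha y Hy')).
now rewrite (is_pseries_unique _ _ _ (Hb y Hy')).
Qed.

Lemma power_series_unique (f : C -> C) (a b : nat -> C) :
  power_series_on_disc f a -> power_series_on_disc f b ->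
  forall k, a k = b k.
Proof.
intros Ha Hb k.
assert (D : forall x, Rabs x < 1 -> unit_disc (RtoC x)).
{ intros x Hx. unfold unit_disc. now rewrite Cmod_R. }
apply injective_projections.
- apply (real_coefficients_unique (fun k => Re (a k)) (fun k => Re (b k))
    (fun x => Re (f (RtoC x)))); intros x Hx; apply is_pseries_Re_Im; auto.
- apply (real_coefficients_unique (fun k => Im (a k)) (fun k => Im (b k))
    (fun x => Im (f (RtoC x)))); intros x Hx; apply is_pseries_Re_Im; auto.
Qed.

Lemma partial_sum_unique (f : C -> C) (a : nat -> C) :
  power_series_on_disc f a ->
  forall (n : nat) (z : C), partial_sum n f z = sum_n (fun k => a k * z ^ k)%C n.
Proof.
intros Ha n z. apply sum_n_ext. intros k. f_equal.
apply (power_series_unique f); [|exact Ha].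
unfold coefficients. apply epsilon_spec. now exists a.
Qed.

(* Main.v *)
(** Put w = -Bz, let S be the n-th partial sum of (1-w)^(-mu) with coefficients
    c_k, and take 1 + B omega = F with F = (1-w) S^(1/lambda).  The recursion
    (k+1) c_(k+1) = (mu+k) c_k gives (1-w) S' = mu S - (mu+n) c_n w^n, whence
      -F' = (1 - mu/lambda) S^(1/lambda)
            + ((mu+n)/lambda) c_n w^n S^(1/lambda-1).
    Both exponents are nonnegative and S has positive coefficients, so
    |F'(w)| <= -F'(|w|).  Integrating along the radius,
    |1 - F(w)| <= 1 - F(|w|) <= |w|, that is |omega(z)| <= |z|.
    The case lambda = 1 shows that (1-w) S lies in the right half plane, which
    provides the branch Log((1-w) S) - Log(1-w) of log S.  The same identity for
    S' shows that S (1-w)^mu tends to 1 as n grows, so the c_k are indeed the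
    Taylor coefficients. *)

Require Import Defs.
From Stdlib Require Import Reals Lra Lia.
From Coquelicot Require Import Coquelicot.
Open Scope R_scope.

(** * Complex derivatives *)

(* [C] is its own normed module here, which has the product rule, unlike the
   [C_NormedModule] used in [analytic_on_disc]. *)
Definition cderiv (f : C -> C) (z l : C) : Prop :=
  @is_derive C_AbsRing (AbsRing_NormedModule C_AbsRing) f z l.

Lemma cderiv_ex_derive (f : C -> C) (z l : C) :
  cderiv f z l -> @ex_derive C_AbsRing C_NormedModule f z.
Proof. intros [_ H]. exists l. split; [apply is_linear_scal_l|exact H]. Qed.

Lemma cderiv_epsilon (f : C -> C) (z l : C) :
  cderiv f z l <->
  forall eps, 0 < eps -> exists d, 0 < d /\ forall y, Cmod (y - z) < d ->
    Cmod (f y - f z - (y - z) * l) <= eps * Cmod (y - z).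
Proof.
split.
- intros [_ H] eps He.
  destruct (H z (fun P HP => HP) (mkposreal eps He)) as [d Hd].
  exists d. split; [apply cond_pos|]. intros y Hy. apply (Hd y Hy).
- intros H. split; [apply is_linear_scal_l|].
  intros x Hx eps.
  (* The little-o condition is required at every limit point of the filter [locally z], and [z] is
     the only one. *)
  assert (E : z = x) by exact (@is_filter_lim_locally_unique C_AbsRing (AbsRing_NormedModule C_AbsRing) z x Hx).
  rewrite <- E.
  destruct (H eps (cond_pos eps)) as (d & Hd & Hy).
  exists (mkposreal d Hd). intros y Hyd. apply Hy. exact Hyd.
Qed.

Lemma cderiv_ext (f g : C -> C) (z l : C) :
  (forall x, f x = g x) -> cderiv f z l -> cderiv g z l.
Proof. intros H. apply (@is_derive_ext C_AbsRing (AbsRing_NormedModule C_AbsRing) f g z l H). Qed.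

Lemma cderiv_const (a z : C) : cderiv (fun _ => a) z (RtoC 0).
Proof. apply (@is_derive_const C_AbsRing (AbsRing_NormedModule C_AbsRing)). Qed.

Lemma cderiv_id (z : C) : cderiv (fun x => x) z (RtoC 1).
Proof. apply (@is_derive_id C_AbsRing). Qed.

Lemma cderiv_plus (f g : C -> C) (z l m : C) :
  cderiv f z l -> cderiv g z m -> cderiv (fun x => f x + g x)%C z (l + m)%C.
Proof. apply (@is_derive_plus C_AbsRing (AbsRing_NormedModule C_AbsRing)). Qed.

Lemma cderiv_minus (f g : C -> C) (z l m : C) :
  cderiv f z l -> cderiv g z m -> cderiv (fun x => f x - g x)%C z (l - m)%C.
Proof. apply (@is_derive_minus C_AbsRing (AbsRing_NormedModule C_AbsRing)). Qed.

Lemma cderiv_mult (f g : C -> C) (z l m : C) :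
  cderiv f z l -> cderiv g z m ->
  cderiv (fun x => f x * g x)%C z (l * g z + f z * m)%C.
Proof. intros Hf Hg. apply (@is_derive_mult C_AbsRing); auto. intros a b. apply Cmult_comm. Qed.

Lemma cderiv_scal (a : C) (f : C -> C) (z l : C) :
  cderiv f z l -> cderiv (fun x => a * f x)%C z (a * l)%C.
Proof.
intros Hf. replace (a * l)%C with (0 * f z + a * l)%C by ring.
apply cderiv_mult; [apply cderiv_const|exact Hf].
Qed.

Lemma cderiv_comp (f g : C -> C) (z l m : C) :
  cderiv f (g z) l -> cderiv g z m -> cderiv (fun x => f (g x)) z (m * l)%C.
Proof. apply (@is_derive_comp C_AbsRing (AbsRing_NormedModule C_AbsRing)). Qed.

(** * Plane curves and the mean value inequality along a segment *)

(** Split into components so that real differentiation and the real mean value theorem apply. *)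
Definition curve_deriv (phi : R -> C) (t : R) (l : C) : Prop :=
  is_derive (fun s => Re (phi s)) t (Re l) /\
  is_derive (fun s => Im (phi s)) t (Im l).

(** Projecting on the chord [D = phi 1 - phi 0] reduces this to a real statement: by Cauchy-Schwarz
    [g * |D| - <D, phi>] is nondecreasing, and comparing its end values gives |D|^2 <= (g 1 - g 0)
    |D|. *)
Lemma segment_mvt (phi phi' : R -> C) (g g' : R -> R) :
  (forall t, 0 <= t <= 1 -> curve_deriv phi t (phi' t)) ->
  (forall t, 0 <= t <= 1 -> is_derive g t (g' t)) ->
  (forall t, 0 <= t <= 1 -> Cmod (phi' t) <= g' t) ->
  Cmod (phi 1 - phi 0) <= g 1 - g 0.
Proof.
intros Hphi Hg Hle.
assert (mono : forall k k' : R -> R,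
  (forall t, 0 <= t <= 1 -> is_derive k t (k' t)) ->
  (forall t, 0 <= t <= 1 -> 0 <= k' t) -> k 0 <= k 1).
{ intros k k' Hk Hk'.
  destruct (MVT_gen k 0 1 k') as (c & Hc & E).
  - rewrite Rmin_left, Rmax_right by lra. intros; apply Hk; lra.
  - rewrite Rmin_left, Rmax_right by lra. intros x Hx.
    apply continuity_pt_filterlim, (ex_derive_continuous k).
    exists (k' x). auto.
  - rewrite Rmin_left, Rmax_right in Hc by lra.
    specialize (Hk' c Hc). lra. }
set (D := (phi 1 - phi 0)%C).
(* For [D = 0] there is nothing to divide by, but [g] is nondecreasing because [g'] dominates a
   modulus. *)
destruct (Req_dec (Cmod D) 0) as [E|E].
- rewrite E. enough (g 0 <= g 1) by lra.
  apply (mono g g' Hg). intros t Ht. apply Rle_trans with (2 := Hle t Ht), Cmod_ge_0.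
- assert (Dpos : 0 < Cmod D) by (generalize (Cmod_ge_0 D); lra).
  assert (M : g 0 * Cmod D - (Re D * Re (phi 0) + Im D * Im (phi 0))
    <= g 1 * Cmod D - (Re D * Re (phi 1) + Im D * Im (phi 1))).
  { apply (mono (fun t => g t * Cmod D - (Re D * Re (phi t) + Im D * Im (phi t)))
      (fun t => g' t * Cmod D - (Re D * Re (phi' t) + Im D * Im (phi' t)))).
    - intros t Ht. destruct (Hphi t Ht) as [HR HI].
      specialize (Hg t Ht).
      apply (is_derive_minus (fun t => g t * Cmod D) (fun t => Re D * Re (phi t) + Im D * Im (phi t))).
      + apply (is_derive_scal_l g t (g' t) (Cmod D) Hg).
      + apply (is_derive_plus (fun t => Re D * Re (phi t)) (fun t => Im D * Im (phi t)));
        apply is_derive_scal; assumption.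
    - intros t Ht.
      assert (H1 : Re D * Re (phi' t) + Im D * Im (phi' t) <= Cmod D * Cmod (phi' t)).
      (* The inner product is the real part of conj(D) phi', hence at most |D| |phi'|. *)
      { replace (Re D * Re (phi' t) + Im D * Im (phi' t)) with (Re (Cconj D * phi' t))
          by (unfold Re, Im, Cconj, Cmult; simpl; ring).
        rewrite <- (Cmod_conj D), <- Cmod_mult.
        apply Rle_trans with (2 := re_le_Cmod _), Rle_abs. }
      specialize (Hle t Ht). nra. }
  assert (E2 : Cmod D * Cmod D = Re D * Re D + Im D * Im D).
  { generalize (Cmod2_alt D). simpl. lra. }
  assert (HR : Re D = Re (phi 1) - Re (phi 0)) by (unfold D, Re; simpl; ring).
  assert (HI : Im D = Im (phi 1) - Im (phi 0)) by (unfold D, Im; simpl; ring).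
  apply Rmult_le_reg_r with (Cmod D); [exact Dpos|].
  assert (HR2 : Re D * Re D = Re D * (Re (phi 1) - Re (phi 0))) by now rewrite <- HR.
  assert (HI2 : Im D * Im D = Im D * (Im (phi 1) - Im (phi 0))) by now rewrite <- HI.
  lra.
Qed.

Lemma cderiv_curve (f : C -> C) (z u l : C) (t : R) :
  cderiv f (z + t * u)%C l -> curve_deriv (fun s => f (z + s * u)%C) t (u * l)%C.
Proof.
intros H.
assert (K : forall eps, 0 < eps -> exists d, 0 < d /\ forall s, Rabs (s - t) < d ->
   Cmod (f (z + s * u) - f (z + t * u) - (s - t)%R * (u * l))%C <= eps * Rabs (s - t)).
{ intros eps He. rewrite cderiv_epsilon in H.
  (* Adding 1 keeps the divisor positive when [u = 0]. *)
  set (m := Cmod u + 1).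
  assert (Hm : Cmod u < m) by (unfold m; lra).
  assert (Hu := Cmod_ge_0 u).
  assert (Hm0 : 0 < m) by lra.
  destruct (H (eps / m)) as (d & Hd & Hy); [apply Rdiv_lt_0_compat; lra|].
  exists (d / m). split; [apply Rdiv_lt_0_compat; lra|].
  intros s Hs.
  assert (E : (z + s * u - (z + t * u) = (s - t)%R * u)%C).
  { rewrite RtoC_minus. ring. }
  assert (E2 : Cmod (z + s * u - (z + t * u)) = Rabs (s - t) * Cmod u).
  { rewrite E, Cmod_mult, Cmod_R. reflexivity. }
  specialize (Hy (z + s * u)%C). rewrite E2 in Hy.
  assert (Hst := Rabs_pos (s - t)).
  apply (Rmult_lt_compat_r m) in Hs; [|lra].
  replace (d / m * m) with d in Hs by (field; lra).
  apply Rle_trans with (eps / m * (Rabs (s - t) * Cmod u)).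
  - rewrite E in Hy.
    replace ((s - t)%R * (u * l))%C with ((s - t)%R * u * l)%C by ring.
    apply Hy. nra.
  - replace (eps / m * (Rabs (s - t) * Cmod u)) with (eps * Rabs (s - t) * (Cmod u / m)) by (field; lra).
    assert (Cmod u / m <= 1) by (apply (Rmult_le_reg_r m); [lra|unfold Rdiv; rewrite Rmult_assoc, Rinv_l; lra]).
    assert (0 <= eps * Rabs (s - t)) by nra. nra. }
split; (split; [apply is_linear_scal_l|]); intros x Hx eps;
  assert (E : t = x) by exact (is_filter_lim_locally_unique t x Hx); rewrite <- E;
  destruct (K eps (cond_pos eps)) as (d & Hd & Hs);
  exists (mkposreal d Hd); intros s Hsd; specialize (Hs s Hsd);
  (eapply Rle_trans; [|exact Hs]).
- eapply Rle_trans; [|apply re_le_Cmod]. apply Req_le.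
  change (Rabs (Re (f (z + s * u)%C) - Re (f (z + t * u)%C) - (s - t) * Re (u * l)%C)
    = Rabs (Re (f (z + s * u) - f (z + t * u) - (s - t)%R * (u * l))%C)).
  f_equal. unfold Re. simpl. ring.
- eapply Rle_trans; [|apply Rle_trans with (2 := Rmax_Cmod _), Rmax_r]. apply Req_le.
  change (Rabs (Im (f (z + s * u)%C) - Im (f (z + t * u)%C) - (s - t) * Im (u * l)%C)
    = Rabs (Im (f (z + s * u) - f (z + t * u) - (s - t)%R * (u * l))%C)).
  f_equal. unfold Im. simpl. ring.
Qed.

(* A Gateaux derivative that is continuous at [z0] is a complex derivative. *)
Lemma cderiv_of_directional (f f' : C -> C) (z0 : C) (r : R) :
  0 < r ->
  (forall z u t, Cmod (z + RtoC t * u - z0) < r ->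
     curve_deriv (fun s => f (z + s * u)%C) t (u * f' (z + t * u)%C)%C) ->
  (forall eps, 0 < eps -> exists d, 0 < d /\ forall y, Cmod (y - z0) < d ->
    Cmod (f' y - f' z0) <= eps) ->
  cderiv f z0 (f' z0).
Proof.
intros Hr Hdir Hcont. apply cderiv_epsilon. intros eps He.
destruct (Hcont eps He) as (d & Hd & Hy).
exists (Rmin d r). split; [now apply Rmin_pos|]. intros y Hyd.
assert (H1 := Rmin_l d r). assert (H2 := Rmin_r d r).
set (u := (y - z0)%C).
assert (Hseg : forall t, 0 <= t <= 1 -> Cmod (z0 + RtoC t * u - z0) <= Cmod u).
{ intros t Ht. replace (z0 + t * u - z0)%C with (t * u)%C by ring.
  rewrite Cmod_mult, Cmod_R, Rabs_pos_eq by lra. generalize (Cmod_ge_0 u). nra. }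
fold u in Hyd.
(* The error is the increment over [0, 1] of [f] minus its linear part along the segment from [z0]
   to [y]. Its velocity is [u] times a difference of values of [f'], small by continuity. *)
replace (f y - f z0 - u * f' z0)%C with
  ((fun t : R => f (z0 + t * u) - t * (u * f' z0)) 1 - (fun t : R => f (z0 + t * u) - t * (u * f' z0)) 0)%C.
2:{ simpl. replace (z0 + 1 * u)%C with y by (unfold u; ring).
    replace (z0 + 0 * u)%C with z0 by ring. ring. }
replace (eps * Cmod u) with ((fun t => t * (eps * Cmod u)) 1 - (fun t => t * (eps * Cmod u)) 0) by ring.
apply (segment_mvt (fun t : R => f (z0 + t * u) - t * (u * f' z0))%C
  (fun t => u * (f' (z0 + t * u) - f' z0))%C (fun t => t * (eps * Cmod u)) (fun _ => eps * Cmod u)).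
- intros t Ht. destruct (Hdir z0 u t) as [HR HI]; [specialize (Hseg t Ht); lra|].
  set (a := f' (z0 + t * u)%C) in *. set (b := f' z0).
  split.
  + apply is_derive_ext with (fun s : R => Re (f (z0 + s * u)%C) - s * Re (u * b)%C).
    { intros s. unfold Re. simpl. ring. }
    replace (Re (u * (a - b))%C) with (Re (u * a)%C - Re (u * b)%C) by (unfold Re; simpl; ring).
    apply (is_derive_minus (fun s : R => Re (f (z0 + s * u)%C)) (fun s : R => s * Re (u * b)%C)); [exact HR|].
    auto_derive; [easy|]; apply Rmult_1_l.
  + apply is_derive_ext with (fun s : R => Im (f (z0 + s * u)%C) - s * Im (u * b)%C).
    { intros s. unfold Im. simpl. ring. }
    replace (Im (u * (a - b))%C) with (Im (u * a)%C - Im (u * b)%C) by (unfold Im; simpl; ring).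
    apply (is_derive_minus (fun s : R => Im (f (z0 + s * u)%C)) (fun s : R => s * Im (u * b)%C)); [exact HI|].
    auto_derive; [easy|]; apply Rmult_1_l.
- intros t Ht. auto_derive; [easy|ring].
- intros t Ht. rewrite Cmod_mult, Rmult_comm.
  apply Rmult_le_compat_r; [apply Cmod_ge_0|]. apply Hy.
  specialize (Hseg t Ht). lra.
Qed.

(** * The complex exponential *)

Lemma Cexp_plus (z w : C) : Cexp (z + w) = (Cexp z * Cexp w)%C.
Proof.
unfold Cexp, Cmult, Re, Im; simpl. rewrite exp_plus, cos_plus, sin_plus.
f_equal; ring.
Qed.

Lemma Cexp_RtoC (x : R) : Cexp (RtoC x) = RtoC (exp x).
Proof. unfold Cexp, RtoC; simpl. rewrite cos_0, sin_0. f_equal; ring. Qed.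

Lemma Cmod_Cexp (z : C) : Cmod (Cexp z) = exp (Re z).
Proof.
unfold Cmod, Cexp; simpl.
replace (_ + _) with (exp (Re z) * exp (Re z) * ((sin (Im z))² + (cos (Im z))²)) by (unfold Rsqr; ring).
rewrite sin2_cos2, Rmult_1_r. apply sqrt_square, Rlt_le, exp_pos.
Qed.

Lemma Cexp_neq_0 (z : C) : Cexp z <> RtoC 0.
Proof. apply Cmod_gt_0. rewrite Cmod_Cexp. apply exp_pos. Qed.

Lemma Cexp_opp (z : C) : Cexp (- z) = (/ Cexp z)%C.
Proof.
assert (H := Cexp_neq_0 z).
assert (E : (Cexp (- z) * Cexp z = 1)%C).
{ rewrite <- Cexp_plus. replace (- z + z)%C with (RtoC 0) by ring.
  now rewrite Cexp_RtoC, exp_0. }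
replace (Cexp (- z)) with (Cexp (- z) * Cexp z * / Cexp z)%C by (field; exact H).
rewrite E. ring.
Qed.

Lemma Cexp_curve_deriv (z u : C) (t : R) :
  curve_deriv (fun s => Cexp (z + s * u)) t (u * Cexp (z + t * u))%C.
Proof.
destruct z as [x y]. destruct u as [a b].
unfold curve_deriv, Cexp, Re, Im; simpl. split; auto_derive; trivial; unfold Rminus; ring.
Qed.

(** The segment from 0 to [h] stays where the real part is at most 1, so the exponential has modulus
    at most e along it. *)
Lemma Cmod_Cexp_minus_1 (h : C) :
  Cmod h <= 1 -> Cmod (Cexp h - 1) <= exp 1 * Cmod h.
Proof.
intros Hh.
replace (Cexp h - 1)%C with ((fun s : R => Cexp (0 + s * h)) 1 - (fun s : R => Cexp (0 + s * h)) 0)%C.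
2:{ simpl. replace (0 + 1 * h)%C with h by ring.
  replace (0 + 0 * h)%C with (RtoC 0) by ring. now rewrite Cexp_RtoC, exp_0. }
replace (exp 1 * Cmod h) with ((fun t => t * (exp 1 * Cmod h)) 1 - (fun t => t * (exp 1 * Cmod h)) 0) by ring.
apply (segment_mvt (fun s : R => Cexp (0 + s * h)) (fun s => h * Cexp (0 + s * h))%C (fun t => t * (exp 1 * Cmod h)) (fun _ => exp 1 * Cmod h)).
- intros t _. apply Cexp_curve_deriv.
- intros t _. auto_derive; trivial. ring.
- intros t Ht. rewrite Cmod_mult, Cmod_Cexp, Rmult_comm.
  apply Rmult_le_compat_r; [apply Cmod_ge_0|].
  replace (Re (0 + t * h)%C) with (t * Re h) by (unfold Re; simpl; ring).
  assert (H := Rle_trans _ _ _ (Rle_abs (Re h)) (re_le_Cmod h)).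
  destruct (Rle_lt_or_eq_dec (t * Re h) 1) as [H1|H1]; [nra| |].
  + now apply Rlt_le, exp_increasing.
  + rewrite H1. apply Rle_refl.
Qed.

Lemma cderiv_Cexp (z : C) : cderiv Cexp z (Cexp z).
Proof.
apply (cderiv_of_directional Cexp Cexp z 1); [lra| |].
- intros z1 u t _. apply Cexp_curve_deriv.
(* The functional equation moves continuity at [z] to continuity at 0; [K] is a Lipschitz constant
   valid within distance 1 of [z]. *)
- intros eps He. set (K := exp (Re z) * exp 1).
  assert (HK : 0 < K) by (apply Rmult_lt_0_compat; apply exp_pos).
  exists (Rmin 1 (eps / K)).
  split; [apply Rmin_pos; [lra|now apply Rdiv_lt_0_compat]|].
  intros y Hy. assert (H1 := Rmin_l 1 (eps / K)). assert (H2 := Rmin_r 1 (eps / K)).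
  replace y with (z + (y - z))%C at 1 by ring.
  rewrite Cexp_plus.
  replace (Cexp z * Cexp (y - z) - Cexp z)%C with (Cexp z * (Cexp (y - z) - 1))%C by ring.
  rewrite Cmod_mult, Cmod_Cexp.
  assert (H3 := Cmod_Cexp_minus_1 (y - z) ltac:(lra)).
  apply Rle_trans with (K * Cmod (y - z)).
  + unfold K. rewrite Rmult_assoc. apply Rmult_le_compat_l; [|exact H3].
    apply Rlt_le, exp_pos.
  + replace eps with (K * (eps / K)) by (field; lra).
    apply Rmult_le_compat_l; lra.
Qed.

(** * The principal logarithm on the right half plane *)

(* [Clog] on the right half plane, without the case distinction of [Arg]. *)
Definition right_Clog (w : C) : C :=
  (ln (Re w ^ 2 + Im w ^ 2) / 2, atan (Im w / Re w)).

(** Brings out the square root that occurs in the cosine and sine of an arctangent. *)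
Lemma Cmod_right (w : C) : 0 < Re w ->
  Cmod w = Re w * sqrt (1 + (Im w / Re w)²).
Proof.
intros Hw. rewrite <- (sqrt_square (Re w)) at 1 by lra.
rewrite <- sqrt_mult_alt by nra. unfold Cmod. f_equal.
change (fst w) with (Re w). change (snd w) with (Im w).
unfold Rsqr. field. lra.
Qed.

Lemma cos_atan_slope (w : C) : 0 < Re w -> cos (atan (Im w / Re w)) = Re w / Cmod w.
Proof.
intros Hw. rewrite cos_atan, Cmod_right by exact Hw.
assert (0 < sqrt (1 + (Im w / Re w)²)) by (apply sqrt_lt_R0; generalize (Rle_0_sqr (Im w / Re w)); lra).
field. lra.
Qed.

Lemma sin_atan_slope (w : C) : 0 < Re w -> sin (atan (Im w / Re w)) = Im w / Cmod w.
Proof.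
intros Hw. rewrite sin_atan, Cmod_right by exact Hw.
assert (0 < sqrt (1 + (Im w / Re w)²)) by (apply sqrt_lt_R0; generalize (Rle_0_sqr (Im w / Re w)); lra).
field. lra.
Qed.

Lemma Cmod_pos_right (w : C) : 0 < Re w -> 0 < Cmod w.
Proof. intros Hw. generalize (re_le_Cmod w). rewrite Rabs_pos_eq; lra. Qed.

(** The polar angle is the arctangent of the slope and lies in (-PI/2, PI/2). From its cosine [acos]
    recovers the absolute value, and the test on [Im w] in [Arg] restores the sign. *)
Lemma Clog_right (w : C) : 0 < Re w -> Clog w = right_Clog w.
Proof.
intros Hw. unfold Clog, right_Clog. f_equal.
- unfold Cmod. rewrite <- (sqrt_sqrt (Re w ^ 2 + Im w ^ 2)) by nra.
  change (fst w) with (Re w). change (snd w) with (Im w).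
  assert (0 < sqrt (Re w ^ 2 + Im w ^ 2)) by (apply sqrt_lt_R0; nra).
  rewrite ln_mult by assumption. field.
- unfold Arg. rewrite <- cos_atan_slope by exact Hw.
  destruct (atan_bound (Im w / Re w)) as [H1 H2].
  destruct (Rle_dec 0 (Im w)) as [H|H].
  + apply acos_cos. split; [|lra].
    rewrite <- atan_0. destruct (Req_dec (Im w) 0) as [E|E].
    * rewrite E. unfold Rdiv. rewrite Rmult_0_l. lra.
    * apply Rlt_le, atan_increasing, Rdiv_lt_0_compat; lra.
  + rewrite <- cos_neg, acos_cos; [ring|]. split; [|lra].
    assert (atan (Im w / Re w) < atan 0); [|rewrite atan_0 in *; lra].
    apply atan_increasing.
    assert (0 < (- Im w) / Re w) by (apply Rdiv_lt_0_compat; lra).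
    unfold Rdiv in *. lra.
Qed.

Lemma Cexp_Clog (w : C) : 0 < Re w -> Cexp (Clog w) = w.
Proof.
intros Hw. assert (H := Cmod_pos_right w Hw).
assert (EI : Im (Clog w) = atan (Im w / Re w)) by now rewrite Clog_right.
unfold Cexp. rewrite EI. change (Re (Clog w)) with (ln (Cmod w)).
rewrite exp_ln, cos_atan_slope, sin_atan_slope by assumption.
apply injective_projections; simpl; unfold Re, Im; field; lra.
Qed.

Lemma Clog_RtoC (x : R) : 0 < x -> Clog (RtoC x) = RtoC (ln x).
Proof.
intros Hx. apply injective_projections.
- simpl. rewrite Cmod_R, Rabs_pos_eq; lra.
- rewrite Clog_right by exact Hx. simpl. unfold Rdiv.
  rewrite Rmult_0_l. apply atan_0.
Qed.

(** Keeps the disc of radius [Re z] about a point [z] of the right half plane inside that half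
    plane. *)
Lemma Re_Cmod_minus (y z : C) : Re z - Cmod (y - z) <= Re y.
Proof.
assert (H := re_le_Cmod (y - z)).
replace (Re (y - z)%C) with (Re y - Re z) in H by (unfold Re; simpl; ring).
apply Rabs_le_between in H. lra.
Qed.

Lemma cderiv_Clog (z : C) : 0 < Re z -> cderiv Clog z (/ z)%C.
Proof.
intros Hz.
assert (D : cderiv right_Clog z (/ z)%C).
{ apply (cderiv_of_directional right_Clog Cinv z (Re z) Hz).
  - intros z1 u t Ht.
    assert (Hp : 0 < Re (z1 + t * u)%C) by (generalize (Re_Cmod_minus (z1 + t * u) z); lra).
    destruct z1 as [x y]. destruct u as [a b].
    unfold curve_deriv, right_Clog, Re, Im in *; simpl in *.
    set (p := x + (t * a + - (0 * b))).
    change (0 < p) in Hp. set (q := y + (t * b + 0 * a)).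
    assert (0 < p * (p * 1) + q * (q * 1)) by nra.
    split; auto_derive; fold q; fold p; change (x + (t * a - 0 * b)) with p.
    + lra.
    + field. lra.
    + lra.
    + simpl. clearbody p q. field. lra.
  - intros eps He. assert (Hm := Cmod_pos_right z Hz).
    set (m := Cmod z) in *.
    (* Within [m / 2] of [z] one has |y| > m/2, so |1/y - 1/z| = |y - z| / (|y| m) is at most 2 |y -
       z| / m^2. *)
    exists (Rmin (m / 2) (eps * (m * m / 2))).
    assert (0 < m * m) by nra.
    split; [apply Rmin_pos; [lra|apply Rmult_lt_0_compat; lra]|].
    intros y Hy. assert (H1 := Rmin_l (m / 2) (eps * (m * m / 2))).
    assert (H2 := Rmin_r (m / 2) (eps * (m * m / 2))).
    assert (Hym : m / 2 < Cmod y).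
    { assert (T := Cmod_triangle y (- (y - z))).
      rewrite Cmod_opp in T. replace (y + - (y - z))%C with z in T by ring.
      fold m in T. lra. }
    assert (Hy0 : y <> RtoC 0) by (apply Cmod_gt_0; lra).
    assert (Hz0 : z <> RtoC 0) by (apply Cmod_gt_0; fold m; lra).
    replace (/ y - / z)%C with (- (y - z) / (y * z))%C by (field; auto).
    rewrite Cmod_div by now apply Cmult_neq_0.
    rewrite Cmod_opp, Cmod_mult. fold m.
    apply (Rmult_le_reg_r (Cmod y * m)); [nra|].
    replace (Cmod (y - z) / (Cmod y * m) * (Cmod y * m)) with (Cmod (y - z)) by (field; lra).
    assert (m * m / 2 <= Cmod y * m) by nra. nra. }
rewrite cderiv_epsilon in D. apply cderiv_epsilon. intros eps He.
destruct (D eps He) as (d & Hd & H).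
exists (Rmin d (Re z)). split; [now apply Rmin_pos|]. intros y Hy.
assert (H1 := Rmin_l d (Re z)). assert (H2 := Rmin_r d (Re z)).
rewrite !Clog_right; [apply H; lra|exact Hz|].
generalize (Re_Cmod_minus y z). lra.
Qed.

(** * Mean value bounds along radii of the disc *)

Lemma disc_mvt (f f' : C -> C) (z : C) (M : R) :
  (forall x, Cmod x <= Cmod z -> cderiv f x (f' x)) ->
  (forall x, Cmod x <= Cmod z -> Cmod (f' x) <= M) ->
  Cmod (f z - f 0%R) <= M * Cmod z.
Proof.
intros Hf HM.
assert (Hs : forall t, 0 <= t <= 1 -> Cmod (RtoC 0 + RtoC t * z) <= Cmod z).
{ intros t Ht. rewrite Cplus_0_l, Cmod_mult, Cmod_R, Rabs_pos_eq by lra.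
  generalize (Cmod_ge_0 z). nra. }
replace (f z - f 0%R)%C with ((fun t : R => f (0 + t * z)) 1 - (fun t : R => f (0 + t * z)) 0)%C.
2:{ simpl. f_equal; [|f_equal]; f_equal; ring. }
replace (M * Cmod z) with ((fun t => t * (M * Cmod z)) 1 - (fun t => t * (M * Cmod z)) 0) by ring.
apply (segment_mvt (fun t : R => f (0 + t * z)%C) (fun t => z * f' (0 + t * z))%C (fun t => t * (M * Cmod z)) (fun _ => M * Cmod z)).
- intros t Ht. apply cderiv_curve, Hf, Hs, Ht.
- intros t _. auto_derive; trivial. ring.
- intros t Ht. rewrite Cmod_mult, Rmult_comm.
  apply Rmult_le_compat_r; [apply Cmod_ge_0|]. apply HM, Hs, Ht.
Qed.

(** The curve t -> f(tz) moves no faster than the real function t -> Re f(t|z|) grows, so its chord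
    is bounded by the growth of the latter. *)
Lemma majorant_mvt (f f' : C -> C) (z : C) :
  (forall x, Cmod x < 1 -> cderiv f x (f' x)) ->
  (forall x, Cmod x < 1 -> Cmod (f' x) <= Re (f' (Cmod x))) ->
  Cmod z < 1 ->
  Cmod (f z - f 0%R) <= Re (f (Cmod z)) - Re (f 0%R).
Proof.
intros Hf HM Hz. set (r := Cmod z) in *.
assert (Hr := Cmod_ge_0 z). fold r in Hr.
assert (Hs : forall u : C, Cmod u = r -> forall t, 0 <= t <= 1 -> Cmod (RtoC 0 + RtoC t * u) = t * r).
{ intros u Hu t Ht. rewrite Cplus_0_l, Cmod_mult, Cmod_R, Rabs_pos_eq, Hu by lra. ring. }
assert (Hrr : Cmod r = r) by (rewrite Cmod_R; now apply Rabs_pos_eq).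
replace (f z - f 0%R)%C with ((fun t : R => f (0 + t * z)) 1 - (fun t : R => f (0 + t * z)) 0)%C.
2:{ simpl. f_equal; [|f_equal]; f_equal; ring. }
replace (Re (f r) - Re (f 0%R)) with ((fun t : R => Re (f (0 + t * r)%C)) 1 - (fun t : R => Re (f (0 + t * r)%C)) 0).
2:{ simpl. f_equal; [|f_equal]; f_equal; f_equal; ring. }
apply (segment_mvt (fun t : R => f (0 + t * z)%C) (fun t => z * f' (0 + t * z))%C (fun t : R => Re (f (0 + t * r)%C)) (fun t => Re (r * f' (0 + t * r))%C)).
- intros t Ht. apply cderiv_curve, Hf. rewrite Hs by easy. nra.
- intros t Ht.
  destruct (cderiv_curve f 0 r (f' (0 + t * r)%C) t) as [H _]; [|exact H].
  apply Hf. rewrite Hs by easy. nra.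
- intros t Ht. rewrite Cmod_mult. fold r.
  replace (Re (r * f' (0 + t * r))%C) with (r * Re (f' (0 + t * r)%C)) by (unfold Re; simpl; ring).
  apply Rmult_le_compat_l; [exact Hr|].
  eapply Rle_trans; [apply HM; rewrite Hs by easy; nra|].
  rewrite Hs by easy. apply Req_le. do 2 f_equal. rewrite RtoC_mult. ring.
Qed.

(** * Partial sums of the binomial series *)

(** The Taylor coefficient mu (mu+1) ... (mu+k-1) / k! of (1-z)^(-mu). *)
Fixpoint binomial_coef (mu : R) (k : nat) : R :=
  match k with
  | O => 1
  | S k => binomial_coef mu k * (mu + INR k) / INR (S k)
  end.

Definition binomial_sum (mu : R) (n : nat) (z : C) : C :=
  sum_n (fun k => RtoC (binomial_coef mu k) * z ^ k)%C n.

Lemma binomial_coef_S (mu : R) (k : nat) :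
  INR (S k) * binomial_coef mu (S k) = (mu + INR k) * binomial_coef mu k.
Proof. change (binomial_coef mu (S k)) with (binomial_coef mu k * (mu + INR k) / INR (S k)).
field. apply not_0_INR. lia. Qed.

Lemma binomial_coef_pos (mu : R) (k : nat) : 0 < mu -> 0 < binomial_coef mu k.
Proof.
intros Hmu. induction k as [|k IH]; [exact Rlt_0_1|].
change (0 < binomial_coef mu k * (mu + INR k) / INR (S k)).
assert (H := pos_INR k).
apply Rdiv_lt_0_compat; [nra|apply lt_0_INR; lia].
Qed.

(** Each ratio (mu+k)/(k+1) of consecutive coefficients is at most 1. *)
Lemma binomial_coef_le_1 (mu : R) (k : nat) :
  0 < mu <= 1 -> binomial_coef mu k <= 1.
Proof.
intros Hmu. induction k as [|k IH]; [apply Rle_refl|].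
assert (H := binomial_coef_S mu k). rewrite S_INR in H.
assert (H0 := pos_INR k). assert (H1 := binomial_coef_pos mu k (proj1 Hmu)).
nra.
Qed.

Lemma binomial_sum_S (mu : R) (n : nat) (z : C) :
  binomial_sum mu (S n) z =
  (binomial_sum mu n z + RtoC (binomial_coef mu (S n)) * z ^ S n)%C.
Proof. unfold binomial_sum. now rewrite sum_Sn. Qed.

Lemma binomial_sum_O (mu : R) (z : C) : binomial_sum mu 0 z = RtoC 1.
Proof. unfold binomial_sum. rewrite sum_O. simpl. ring. Qed.

Lemma binomial_sum_at_0 (mu : R) (n : nat) : binomial_sum mu n (RtoC 0) = RtoC 1.
Proof.
induction n as [|n IH]; [apply binomial_sum_O|].
rewrite binomial_sum_S, IH. simpl. ring.
Qed.

(** Positive coefficients make the value [s] at [r] a bound on the whole circle, and the constant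
    term alone gives [1 <= s]. *)
Lemma binomial_sum_majorant (mu : R) (n : nat) (r : R) :
  0 < mu -> 0 <= r ->
  exists s, 1 <= s /\ binomial_sum mu n (RtoC r) = RtoC s /\
    forall z, Cmod z = r -> Cmod (binomial_sum mu n z) <= s.
Proof.
intros Hmu Hr. induction n as [|n (s & Hs & E & Hz)].
- exists 1. split; [lra|]. split; [apply binomial_sum_O|].
  intros z _. rewrite binomial_sum_O, Cmod_1. lra.
- assert (Hc := binomial_coef_pos mu (S n) Hmu).
  assert (Hp := pow_le r (S n) Hr).
  exists (s + binomial_coef mu (S n) * r ^ S n). split; [nra|]. split.
  + rewrite binomial_sum_S, E, RtoC_plus, RtoC_mult, RtoC_pow. reflexivity.
  + intros z Ez. rewrite binomial_sum_S.
    eapply Rle_trans; [apply Cmod_triangle|].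
    rewrite Cmod_mult, Cmod_R, Cmod_pow, Ez, Rabs_pos_eq by lra.
    apply Rplus_le_compat_r, Hz, Ez.
Qed.

Lemma cderiv_pow_S (n : nat) (z : C) :
  cderiv (fun x => x ^ S n)%C z (RtoC (INR (S n)) * z ^ n)%C.
Proof.
induction n as [|n IH].
- apply cderiv_ext with (fun x => x); [intros x; simpl; ring|].
  replace (RtoC (INR 1) * z ^ 0)%C with (RtoC 1) by (simpl; ring). apply cderiv_id.
- apply cderiv_ext with (fun x => x * x ^ S n)%C; [reflexivity|].
  replace (RtoC (INR (S (S n))) * z ^ S n)%C with
    (1 * z ^ S n + z * (RtoC (INR (S n)) * z ^ n))%C.
  + apply (cderiv_mult (fun x => x) (fun x => x ^ S n)%C); [apply cderiv_id|exact IH].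
  + rewrite (S_INR (S n)), RtoC_plus, Cpow_S. ring.
Qed.

(** The derivative, solved from (1-z) S' = mu S - (mu+n) c_n z^n. *)
Definition binomial_sum' (mu : R) (n : nat) (z : C) : C :=
  ((RtoC mu * binomial_sum mu n z
    - RtoC ((mu + INR n) * binomial_coef mu n) * z ^ n) / (1 - z))%C.

Lemma one_minus_neq_0 (z : C) : z <> RtoC 1 -> (1 - z)%C <> RtoC 0.
Proof.
intros Hz E. apply Hz. replace z with (1 - (1 - z))%C by ring. rewrite E. ring.
Qed.

Lemma cderiv_binomial_sum (mu : R) (n : nat) (z : C) :
  z <> RtoC 1 -> cderiv (binomial_sum mu n) z (binomial_sum' mu n z).
Proof.
intros Hz. apply one_minus_neq_0 in Hz. induction n as [|n IH].
- apply cderiv_ext with (fun _ => RtoC 1); [intros x; symmetry; apply binomial_sum_O|].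
  unfold binomial_sum'. rewrite binomial_sum_O. simpl.
  replace (_ / _)%C with (RtoC 0); [apply cderiv_const|].
  rewrite Rplus_0_r, Rmult_1_r. field. exact Hz.
- apply cderiv_ext with
    (fun x => binomial_sum mu n x + RtoC (binomial_coef mu (S n)) * x ^ S n)%C.
  { intros x. symmetry. apply binomial_sum_S. }
  replace (binomial_sum' mu (S n) z) with
    (binomial_sum' mu n z + RtoC (binomial_coef mu (S n)) * (RtoC (INR (S n)) * z ^ n))%C.
  + apply cderiv_plus; [exact IH|apply cderiv_scal, cderiv_pow_S].
  (* The coefficient recursion turns (mu+n) c_n into (n+1) c_(n+1), after which both sides are the
     same rational expression. *)
  + unfold binomial_sum'. rewrite <- binomial_coef_S, binomial_sum_S.
    rewrite (S_INR n), !RtoC_mult, !RtoC_plus, Cpow_S. field. exact Hz.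
Qed.

(** * The factor 1 - z and its real powers *)

Lemma cderiv_one_minus (z : C) : cderiv (fun x => 1 - x)%C z (- (1))%C.
Proof.
replace (- (1))%C with (0 - 1)%C by ring.
apply cderiv_minus; [apply cderiv_const|apply cderiv_id].
Qed.

Lemma Re_one_minus (z : C) : 1 - Cmod z <= Re (1 - z)%C.
Proof.
assert (H := Re_Cmod_minus (1 - z) 1).
replace (1 - z - 1)%C with (- z)%C in H by ring. rewrite Cmod_opp in H. exact H.
Qed.

Lemma disc_neq_1 (z : C) : Cmod z < 1 -> z <> RtoC 1.
Proof. intros H E. rewrite E, Cmod_1 in H. lra. Qed.

Lemma cderiv_Cpowr_one_minus (q : R) (z : C) : Cmod z < 1 ->
  cderiv (fun x => Cpowr (1 - x) q) z (- (q * Cpowr (1 - z) q / (1 - z)))%C.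
Proof.
intros Hz. assert (H := Re_one_minus z).
assert (H0 := one_minus_neq_0 z (disc_neq_1 z Hz)).
replace (- (q * Cpowr (1 - z) q / (1 - z)))%C with
  (q * (- (1) * / (1 - z)) * Cpowr (1 - z) q)%C by (field; exact H0).
unfold Cpowr.
apply (cderiv_comp Cexp (fun x => RtoC q * Clog (1 - x))%C); [apply cderiv_Cexp|].
apply cderiv_scal, (cderiv_comp Clog (fun x => 1 - x)%C); [|apply cderiv_one_minus].
apply cderiv_Clog. lra.
Qed.

(** * The case lambda = 1: (1-z) S stays in the right half plane *)

(** This is F for lambda = 1. It involves no branch of a power of S, so log S can be built from it
    without circularity. *)
Definition damped_sum (mu : R) (n : nat) (z : C) : C :=
  ((1 - z) * binomial_sum mu n z)%C.

Definition damped_sum' (mu : R) (n : nat) (z : C) : C :=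
  (- ((1 - mu)%R * binomial_sum mu n z
      + RtoC ((mu + INR n) * binomial_coef mu n) * z ^ n))%C.

Lemma remainder_coef_pos (mu : R) (n : nat) :
  0 < mu -> 0 < (mu + INR n) * binomial_coef mu n.
Proof.
intros Hmu. generalize (binomial_coef_pos mu n Hmu) (pos_INR n). nra.
Qed.

Lemma cderiv_damped_sum (mu : R) (n : nat) (z : C) :
  Cmod z < 1 -> cderiv (damped_sum mu n) z (damped_sum' mu n z).
Proof.
intros Hz. apply disc_neq_1 in Hz.
replace (damped_sum' mu n z) with
  (- (1) * binomial_sum mu n z + (1 - z) * binomial_sum' mu n z)%C.
- apply (cderiv_mult (fun x => 1 - x)%C); [apply cderiv_one_minus|].
  now apply cderiv_binomial_sum.
- unfold damped_sum', binomial_sum'. rewrite RtoC_minus. field.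
  now apply one_minus_neq_0.
Qed.

Lemma damped_sum_at_0 (mu : R) (n : nat) : damped_sum mu n (RtoC 0) = RtoC 1.
Proof. unfold damped_sum. rewrite binomial_sum_at_0. ring. Qed.

(** For [mu <= 1] the polynomial [- damped_sum'] has nonnegative coefficients, hence is dominated by
    its values on the positive axis, and the majorant principle applies. *)
Lemma Cmod_one_minus_damped_sum (mu : R) (n : nat) (z : C) :
  0 < mu <= 1 -> Cmod z < 1 -> Cmod (1 - damped_sum mu n z) <= Cmod z.
Proof.
intros Hmu Hz. assert (Hr := Cmod_ge_0 z).
destruct (binomial_sum_majorant mu n (Cmod z) (proj1 Hmu) Hr) as (t & Ht & E & _).
assert (M := majorant_mvt (fun x => 1 - damped_sum mu n x)%C
  (fun x => 0 - damped_sum' mu n x)%C z).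
cbv beta in M.
assert (Er : damped_sum mu n (RtoC (Cmod z)) = RtoC ((1 - Cmod z) * t)).
{ unfold damped_sum. rewrite E, <- RtoC_minus, <- RtoC_mult. reflexivity. }
rewrite damped_sum_at_0, Er in M.
replace (1 - damped_sum mu n z - (1 - 1))%C with (1 - damped_sum mu n z)%C in M by ring.
replace (Re (1 - RtoC ((1 - Cmod z) * t))%C - Re (1 - 1)%C) with
   (1 - (1 - Cmod z) * t) in M by (unfold Re; simpl; ring).
(* With r = |z|, the bound is 1 - (1-r) t, which is at most r because [1 <= t]. *)
eapply Rle_trans; [apply M; [| |exact Hz]|nra].
- intros x Hx. apply cderiv_minus; [apply cderiv_const|now apply cderiv_damped_sum].
- intros x Hx.
  destruct (binomial_sum_majorant mu n (Cmod x) (proj1 Hmu) (Cmod_ge_0 x)) as (u & Hu & Eu & Bu).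
  specialize (Bu x eq_refl). assert (HK := remainder_coef_pos mu n (proj1 Hmu)).
  unfold damped_sum'. set (K := (mu + INR n) * binomial_coef mu n) in *.
  rewrite Eu, <- RtoC_pow, <- !RtoC_mult, <- RtoC_plus, <- RtoC_opp, <- RtoC_minus.
  replace (0 - - ((1 - mu)%R * binomial_sum mu n x + K * x ^ n))%C with
    ((1 - mu)%R * binomial_sum mu n x + K * x ^ n)%C by ring.
  eapply Rle_trans; [apply Cmod_triangle|].
  rewrite !Cmod_mult, !Cmod_R, Cmod_pow, !Rabs_pos_eq by lra.
  simpl. nra.
Qed.

Lemma Re_pos_of_near_1 (w : C) : Cmod (1 - w) < 1 -> 0 < Re w.
Proof.
intros H. assert (T := Re_one_minus (1 - w)).
replace (1 - (1 - w))%C with w in T by ring. lra.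
Qed.

Lemma Re_damped_sum_pos (mu : R) (n : nat) (z : C) :
  0 < mu <= 1 -> Cmod z < 1 -> 0 < Re (damped_sum mu n z).
Proof.
intros Hmu Hz. apply Re_pos_of_near_1.
generalize (Cmod_one_minus_damped_sum mu n z Hmu Hz). lra.
Qed.

Lemma Re_one_minus_pos (z : C) : Cmod z < 1 -> 0 < Re (1 - z)%C.
Proof. intros Hz. generalize (Re_one_minus z). lra. Qed.

Lemma right_neq_0 (w : C) : 0 < Re w -> w <> RtoC 0.
Proof. intros H E. rewrite E in H. simpl in H. lra. Qed.

(** * Logarithm and real powers of the partial sum *)

Lemma binomial_sum_neq_0 (mu : R) (n : nat) (z : C) :
  0 < mu <= 1 -> Cmod z < 1 -> binomial_sum mu n z <> RtoC 0.
Proof.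
intros Hmu Hz E. apply (right_neq_0 _ (Re_damped_sum_pos mu n z Hmu Hz)).
unfold damped_sum. rewrite E. ring.
Qed.

(* The difference of two principal logarithms on the right half plane: [S] itself
   need not lie there. *)
Definition log_sum (mu : R) (n : nat) (z : C) : C :=
  (Clog (damped_sum mu n z) - Clog (1 - z))%C.

Definition pow_sum (mu : R) (n : nat) (q : R) (z : C) : C :=
  Cexp (q * log_sum mu n z).

Lemma Cexp_log_sum (mu : R) (n : nat) (z : C) :
  0 < mu <= 1 -> Cmod z < 1 -> Cexp (log_sum mu n z) = binomial_sum mu n z.
Proof.
intros Hmu Hz. unfold log_sum, Cminus at 1.
rewrite Cexp_plus, Cexp_opp, !Cexp_Clog.
- unfold damped_sum. field. apply one_minus_neq_0, disc_neq_1, Hz.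
- now apply Re_one_minus_pos.
- now apply Re_damped_sum_pos.
Qed.

Lemma Re_log_sum (mu : R) (n : nat) (z : C) :
  0 < mu <= 1 -> Cmod z < 1 -> Re (log_sum mu n z) = ln (Cmod (binomial_sum mu n z)).
Proof.
intros Hmu Hz. rewrite <- Cexp_log_sum, Cmod_Cexp, ln_exp by assumption. reflexivity.
Qed.

Lemma log_sum_RtoC (mu : R) (n : nat) (r s : R) :
  0 <= r < 1 -> 0 < s -> binomial_sum mu n (RtoC r) = RtoC s ->
  log_sum mu n (RtoC r) = RtoC (ln s).
Proof.
intros Hr Hs E. unfold log_sum, damped_sum.
rewrite E, <- !RtoC_minus, <- RtoC_mult.
rewrite !Clog_RtoC, ln_mult by nra. rewrite <- RtoC_minus. f_equal. ring.
Qed.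

Lemma log_sum_at_0 (mu : R) (n : nat) : log_sum mu n (RtoC 0) = RtoC 0.
Proof.
rewrite (log_sum_RtoC mu n 0 1); [now rewrite ln_1|lra|lra|apply binomial_sum_at_0].
Qed.

(** The real part of [log_sum] is ln |S|, so the power has modulus |S|^q, which is monotone in |S|
    for [0 <= q]. *)
Lemma pow_sum_majorant (mu : R) (n : nat) (q : R) (z : C) (s : R) :
  0 < mu <= 1 -> 0 <= q -> Cmod z < 1 ->
  Cmod (binomial_sum mu n z) <= s -> Cmod (pow_sum mu n q z) <= exp (q * ln s).
Proof.
intros Hmu Hq Hz Hs. unfold pow_sum. rewrite Cmod_Cexp.
replace (Re (q * log_sum mu n z)%C) with (q * Re (log_sum mu n z)) by (unfold Re; simpl; ring).
rewrite Re_log_sum by assumption.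
assert (H0 : 0 < Cmod (binomial_sum mu n z)) by now apply Cmod_gt_0, binomial_sum_neq_0.
assert (Hl : ln (Cmod (binomial_sum mu n z)) <= ln s) by now apply ln_le.
assert (Hm : q * ln (Cmod (binomial_sum mu n z)) <= q * ln s) by nra.
destruct Hm as [Hm|Hm]; [now apply Rlt_le, exp_increasing|rewrite Hm; lra].
Qed.

Lemma pow_sum_RtoC (mu : R) (n : nat) (q r s : R) :
  0 <= r < 1 -> 0 < s -> binomial_sum mu n (RtoC r) = RtoC s ->
  pow_sum mu n q (RtoC r) = RtoC (exp (q * ln s)).
Proof.
intros Hr Hs E. unfold pow_sum.
rewrite (log_sum_RtoC mu n r s Hr Hs E), <- RtoC_mult. apply Cexp_RtoC.
Qed.

(** Lets the denominator of S'/S cancel in the derivative of S^q, leaving the exponent q - 1. *)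
Lemma pow_sum_minus_1 (mu : R) (n : nat) (q : R) (z : C) :
  0 < mu <= 1 -> Cmod z < 1 ->
  pow_sum mu n q z = (pow_sum mu n (q - 1) z * binomial_sum mu n z)%C.
Proof.
intros Hmu Hz. rewrite <- Cexp_log_sum by assumption. unfold pow_sum.
rewrite <- Cexp_plus. f_equal. rewrite RtoC_minus. ring.
Qed.

Definition log_sum' (mu : R) (n : nat) (z : C) : C :=
  (binomial_sum' mu n z / binomial_sum mu n z)%C.

(** The contributions of the two factors 1 - z cancel, which leaves S'/S. *)
Lemma cderiv_log_sum (mu : R) (n : nat) (z : C) :
  0 < mu <= 1 -> Cmod z < 1 -> cderiv (log_sum mu n) z (log_sum' mu n z).
Proof.
intros Hmu Hz.
assert (H1 := one_minus_neq_0 z (disc_neq_1 z Hz)).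
assert (H2 := binomial_sum_neq_0 mu n z Hmu Hz).
replace (log_sum' mu n z) with
  (damped_sum' mu n z * / damped_sum mu n z - - (1) * / (1 - z))%C.
- apply cderiv_minus.
  + apply (cderiv_comp Clog); [|now apply cderiv_damped_sum].
    now apply cderiv_Clog, Re_damped_sum_pos.
  + apply (cderiv_comp Clog (fun x => 1 - x)%C); [|apply cderiv_one_minus].
    now apply cderiv_Clog, Re_one_minus_pos.
- unfold log_sum', binomial_sum', damped_sum', damped_sum. rewrite RtoC_minus.
  field. split; assumption.
Qed.

Lemma cderiv_pow_sum (mu : R) (n : nat) (q : R) (z : C) :
  0 < mu <= 1 -> Cmod z < 1 ->
  cderiv (pow_sum mu n q) z (q * log_sum' mu n z * pow_sum mu n q z)%C.
Proof.
intros Hmu Hz. apply (cderiv_comp Cexp (fun x => q * log_sum mu n x)%C).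
- apply cderiv_Cexp.
- now apply cderiv_scal, cderiv_log_sum.
Qed.

(** * The function F that defines the subordination *)

(* The function [1 + B omega] in the variable [w = - B z]. *)
Definition subordination_base (mu lambda : R) (n : nat) (z : C) : C :=
  ((1 - z) * pow_sum mu n (/ lambda) z)%C.

Definition subordination_base' (mu lambda : R) (n : nat) (z : C) : C :=
  (- ((1 - mu / lambda)%R * pow_sum mu n (/ lambda) z
      + RtoC ((mu + INR n) * binomial_coef mu n / lambda) * z ^ n
        * pow_sum mu n (/ lambda - 1) z))%C.

Lemma cderiv_subordination_base (mu lambda : R) (n : nat) (z : C) :
  0 < mu <= 1 -> 0 < lambda -> Cmod z < 1 ->
  cderiv (subordination_base mu lambda n) z (subordination_base' mu lambda n z).
Proof.
intros Hmu Hl Hz.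
assert (H1 := one_minus_neq_0 z (disc_neq_1 z Hz)).
assert (H2 := binomial_sum_neq_0 mu n z Hmu Hz).
replace (subordination_base' mu lambda n z) with
  (- (1) * pow_sum mu n (/ lambda) z
   + (1 - z) * (RtoC (/ lambda) * log_sum' mu n z * pow_sum mu n (/ lambda) z))%C.
- apply (cderiv_mult (fun x => 1 - x)%C); [apply cderiv_one_minus|].
  now apply cderiv_pow_sum.
- unfold subordination_base', log_sum', binomial_sum'.
  rewrite (pow_sum_minus_1 mu n (/ lambda) z) by assumption.
  unfold Rdiv. rewrite RtoC_minus, !RtoC_mult. field. split; assumption.
Qed.

Lemma subordination_base_at_0 (mu lambda : R) (n : nat) : subordination_base mu lambda n (RtoC 0) = RtoC 1.
Proof.
unfold subordination_base, pow_sum. rewrite log_sum_at_0, Cmult_0_r, Cexp_RtoC, exp_0. ring.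
Qed.

(** The majorant argument of the case lambda = 1, with the powers of S also bounded by their values
    on the positive axis. *)
Lemma Cmod_one_minus_subordination_base (mu lambda : R) (n : nat) (z : C) :
  0 < mu -> mu <= lambda -> lambda <= 1 -> Cmod z < 1 ->
  Cmod (1 - subordination_base mu lambda n z) <= Cmod z.
Proof.
intros Hmu Hml Hl Hz. assert (Hr := Cmod_ge_0 z).
assert (Hmu1 : 0 < mu <= 1) by lra.
assert (Hl0 : 0 < / lambda) by (apply Rinv_0_lt_compat; lra).
assert (Hll : / lambda * lambda = 1) by (apply Rinv_l; lra).
destruct (binomial_sum_majorant mu n (Cmod z) Hmu Hr) as (t & Ht & E & _).
assert (M := majorant_mvt (fun x => 1 - subordination_base mu lambda n x)%C
  (fun x => 0 - subordination_base' mu lambda n x)%C z).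
cbv beta in M.
assert (Er : subordination_base mu lambda n (RtoC (Cmod z)) = RtoC ((1 - Cmod z) * exp (/ lambda * ln t))).
{ unfold subordination_base. rewrite (pow_sum_RtoC mu n _ _ t); [|lra|lra|exact E].
  rewrite <- RtoC_minus, <- RtoC_mult. reflexivity. }
(* From [1 <= t] the exponent is nonnegative; this makes the final bound at most |z|. *)
assert (Hpow : 1 <= exp (/ lambda * ln t)).
{ assert (0 <= ln t) by (rewrite <- ln_1; apply ln_le; lra).
  generalize (exp_ineq1_le (/ lambda * ln t)). nra. }
rewrite subordination_base_at_0, Er in M.
replace (1 - subordination_base mu lambda n z - (1 - 1))%C with (1 - subordination_base mu lambda n z)%C in M by ring.
replace (Re (1 - RtoC ((1 - Cmod z) * exp (/ lambda * ln t)))%C - Re (1 - 1)%C) with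
   (1 - (1 - Cmod z) * exp (/ lambda * ln t)) in M by (unfold Re; simpl; ring).
eapply Rle_trans; [apply M; [| |exact Hz]|nra].
- intros x Hx. apply cderiv_minus; [apply cderiv_const|]. apply cderiv_subordination_base; lra.
- intros x Hx.
  destruct (binomial_sum_majorant mu n (Cmod x) Hmu (Cmod_ge_0 x)) as (u & Hu & Eu & Bu).
  specialize (Bu x eq_refl). assert (HK := remainder_coef_pos mu n Hmu).
  assert (Hx0 := Cmod_ge_0 x).
  assert (B1 := pow_sum_majorant mu n (/ lambda) x u Hmu1 ltac:(lra) Hx Bu).
  (* The exponent [/ lambda - 1] is nonnegative because [lambda <= 1]. *)
  assert (B2 := pow_sum_majorant mu n (/ lambda - 1) x u Hmu1 ltac:(nra) Hx Bu).
  unfold subordination_base'.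
  rewrite !(pow_sum_RtoC mu n _ _ u) by (lra || exact Eu).
  assert (HK' : 0 < (mu + INR n) * binomial_coef mu n / lambda) by (apply Rdiv_lt_0_compat; lra).
  (* Here [mu <= lambda] enters: the first summand of -F' gets a nonnegative coefficient. *)
  assert (Hd : 0 <= 1 - mu / lambda) by (unfold Rdiv; nra).
  set (K := (mu + INR n) * binomial_coef mu n / lambda) in *.
  set (d := 1 - mu / lambda) in *.
  rewrite <- RtoC_pow, <- !RtoC_mult, <- RtoC_plus, <- RtoC_opp, <- RtoC_minus.
  match goal with |- Cmod (?o - - ?a)%C <= _ => replace (o - - a)%C with a by ring end.
  eapply Rle_trans; [apply Cmod_triangle|].
  rewrite !Cmod_mult, !Cmod_R, Cmod_pow, !Rabs_pos_eq by lra.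
  assert (Hp : 0 <= K * Cmod x ^ n) by (generalize (pow_le (Cmod x) n Hx0); nra).
  simpl. nra.
Qed.

Lemma Re_subordination_base_pos (mu lambda : R) (n : nat) (z : C) :
  0 < mu -> mu <= lambda -> lambda <= 1 -> Cmod z < 1 -> 0 < Re (subordination_base mu lambda n z).
Proof.
intros H1 H2 H3 Hz. apply Re_pos_of_near_1.
generalize (Cmod_one_minus_subordination_base mu lambda n z H1 H2 H3 Hz). lra.
Qed.

(** A logarithm of a product could differ from the sum of logarithms by a multiple of 2 PI i. Since
    F stays in the right half plane, both sides are differentiable on the disc, with equal
    derivatives and equal values at 0. *)
Lemma Clog_subordination_base (mu lambda : R) (n : nat) (z : C) :
  0 < mu -> mu <= lambda -> lambda <= 1 -> Cmod z < 1 ->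
  Clog (subordination_base mu lambda n z) = (RtoC (/ lambda) * log_sum mu n z + Clog (1 - z))%C.
Proof.
intros H1 H2 H3 Hz.
set (D := fun x => (Clog (subordination_base mu lambda n x)
  - (RtoC (/ lambda) * log_sum mu n x + Clog (1 - x)))%C).
assert (HD : forall x, Cmod x < 1 -> cderiv D x 0).
{ intros x Hx. assert (Hb := Re_subordination_base_pos mu lambda n x H1 H2 H3 Hx).
  assert (Hb0 := right_neq_0 _ Hb).
  assert (Hx1 := one_minus_neq_0 x (disc_neq_1 x Hx)).
  assert (Hp : pow_sum mu n (/ lambda) x <> RtoC 0) by apply Cexp_neq_0.
  (* Zero is written as F'/F minus the derivative of the right-hand side. *)
  replace (RtoC 0) with
    ((- (1) * pow_sum mu n (/ lambda) x
      + (1 - x) * (RtoC (/ lambda) * log_sum' mu n x * pow_sum mu n (/ lambda) x))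
     * / subordination_base mu lambda n x
     - (RtoC (/ lambda) * log_sum' mu n x + - (1) * / (1 - x)))%C.
  2:{ unfold subordination_base. field. split; assumption. }
  apply cderiv_minus; [|apply cderiv_plus].
  - apply (cderiv_comp Clog); [now apply cderiv_Clog|].
    apply (cderiv_mult (fun x => 1 - x)%C); [apply cderiv_one_minus|].
    apply cderiv_pow_sum; lra.
  - apply cderiv_scal, cderiv_log_sum; lra.
  - apply (cderiv_comp Clog (fun x => 1 - x)%C); [|apply cderiv_one_minus].
    now apply cderiv_Clog, Re_one_minus_pos. }
(* The bound 0 on the derivative forces [D] to be constant. *)
assert (M := disc_mvt D (fun _ => RtoC 0) z 0).
assert (D0 : D 0%R = RtoC 0).
{ unfold D. rewrite subordination_base_at_0, log_sum_at_0.
  replace (1 - 0)%C with (RtoC 1) by ring. ring. }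
rewrite D0, Rmult_0_l in M.
assert (E : (D z - 0)%C = RtoC 0).
{ apply Cmod_eq_0, Rle_antisym; [|apply Cmod_ge_0]. apply M.
  - intros x Hx. apply HD. lra.
  - intros x _. rewrite Cmod_0. apply Rle_refl. }
replace (Clog (subordination_base mu lambda n z)) with
  ((D z - 0) + (RtoC (/ lambda) * log_sum mu n z + Clog (1 - z)))%C by (unfold D; ring).
rewrite E. ring.
Qed.

(** Multiplying the logarithm identity by [lambda] and exponentiating gives F^lambda = S
    (1-w)^lambda, which is the subordination identity in the variable w. *)
Lemma Cpowr_subordination_base (mu lambda : R) (n : nat) (z : C) :
  0 < mu -> mu <= lambda -> lambda <= 1 -> Cmod z < 1 ->
  Cpowr (subordination_base mu lambda n z) lambda = (binomial_sum mu n z * Cpowr (1 - z) lambda)%C.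
Proof.
intros H1 H2 H3 Hz. unfold Cpowr. rewrite Clog_subordination_base by assumption.
rewrite <- Cexp_log_sum by (assumption || lra). rewrite <- Cexp_plus. f_equal.
rewrite RtoC_inv by lra. field. intros E. injection E. lra.
Qed.

(** * Convergence of the binomial series and the Taylor coefficients of [v] *)

(* [n + 1] times the last term of a geometric sum is at most the whole sum. *)
Lemma linear_geometric_bound (q : R) (n : nat) :
  0 <= q < 1 -> (1 - q) * (1 + INR n) * q ^ n <= 1 - q ^ S n.
Proof.
intros Hq. induction n as [|n IH]; [simpl; lra|].
rewrite S_INR. change (q ^ S (S n)) with (q * q ^ S n).
change (q ^ S n) with (q * q ^ n) in *.
assert (Hp := pow_le q n (proj1 Hq)).
assert (0 <= q * q ^ n <= 1).
{ split; [nra|]. change (q * q ^ n) with (q ^ S n). rewrite <- (pow1 (S n)). apply pow_incr. lra. }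
apply Rmult_le_compat_l with (r := q) in IH; [|lra]. nra.
Qed.

(** In the derivative of S (1-w)^mu the terms with mu S cancel. What remains is -(mu+n) c_n w^n
    (1-w)^(mu-1), which is integrated from 0, where the product is 1. *)
Lemma binomial_sum_remainder (mu : R) (n : nat) (z : C) :
  0 < mu <= 1 -> Cmod z < 1 ->
  Cmod (binomial_sum mu n z * Cpowr (1 - z) mu - 1)
  <= 2 / (1 - Cmod z) * ((1 + INR n) * Cmod z ^ n).
Proof.
intros Hmu Hz.
assert (Hr := Cmod_ge_0 z).
assert (Hpn := pow_le (Cmod z) n Hr).
assert (Hn := pos_INR n).
assert (HK := remainder_coef_pos mu n (proj1 Hmu)).
assert (HK2 : (mu + INR n) * binomial_coef mu n <= 1 + INR n).
{ generalize (binomial_coef_le_1 mu n Hmu) (binomial_coef_pos mu n (proj1 Hmu)). nra. }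
set (K := (mu + INR n) * binomial_coef mu n) in *.
(* For |x| <= |z|: 2 bounds |(1-x)^mu|, 1/(1-|z|) bounds 1/|1-x|, and 1+n bounds [K]. *)
set (B := 2 / (1 - Cmod z) * ((1 + INR n) * Cmod z ^ n)).
assert (HB : 0 <= B).
{ unfold B. apply Rmult_le_pos; [apply Rlt_le, Rdiv_lt_0_compat; lra|nra]. }
assert (M := disc_mvt (fun x => binomial_sum mu n x * Cpowr (1 - x) mu)%C
  (fun x => - (RtoC K * x ^ n * Cpowr (1 - x) mu / (1 - x)))%C z B).
cbv beta in M. rewrite binomial_sum_at_0 in M.
replace (1 - 0)%C with (RtoC 1) in M by ring.
replace (Cpowr 1 mu) with (RtoC 1) in M.
2:{ unfold Cpowr. rewrite Clog_RtoC, ln_1, Cmult_0_r, Cexp_RtoC, exp_0 by lra. reflexivity. }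
replace (1 * 1)%C with (RtoC 1) in M by ring.
apply Rle_trans with (B * Cmod z); [|nra]. apply M.
- intros x Hx.
  assert (Hx1 := one_minus_neq_0 x (disc_neq_1 x ltac:(lra))).
  replace (- (RtoC K * x ^ n * Cpowr (1 - x) mu / (1 - x)))%C with
    (binomial_sum' mu n x * Cpowr (1 - x) mu
     + binomial_sum mu n x * - (mu * Cpowr (1 - x) mu / (1 - x)))%C.
  + apply (cderiv_mult (binomial_sum mu n) (fun x => Cpowr (1 - x) mu)).
    * apply cderiv_binomial_sum, disc_neq_1. lra.
    * apply cderiv_Cpowr_one_minus. lra.
  + unfold binomial_sum'. fold K. field. exact Hx1.
- intros x Hx. assert (Hx0 := Cmod_ge_0 x).
  assert (Hx1 := one_minus_neq_0 x (disc_neq_1 x ltac:(lra))).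
  rewrite Cmod_opp, Cmod_div, !Cmod_mult, Cmod_R, Cmod_pow, Rabs_pos_eq by (assumption || lra).
  assert (L : 1 - Cmod z <= Cmod (1 - x)).
  { generalize (Re_one_minus x) (re_le_Cmod (1 - x)) (Rle_abs (Re (1 - x)%C)). lra. }
  assert (U : Cmod (1 - x) <= 2).
  { generalize (Cmod_triangle 1 (- x)). rewrite Cmod_opp, Cmod_1.
    change (1 + - x)%C with (1 - x)%C. lra. }
  (* From |1-x| <= 2 and [mu <= 1] the modulus is at most 2^mu <= 2. *)
  assert (P : Cmod (Cpowr (1 - x) mu) <= 2).
  { unfold Cpowr. rewrite Cmod_Cexp.
    replace (Re (mu * Clog (1 - x))%C) with (mu * ln (Cmod (1 - x))) by (unfold Re; simpl; ring).
    apply Rle_trans with (exp (ln 2)); [|rewrite exp_ln; lra].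
    assert (Hl : ln (Cmod (1 - x)) <= ln 2) by (apply ln_le; lra).
    assert (H2 : 0 < ln 2) by (rewrite <- ln_1; apply ln_increasing; lra).
    assert (Hm : mu * ln (Cmod (1 - x)) <= ln 2).
    { apply Rle_trans with (mu * ln 2); [apply Rmult_le_compat_l; lra|].
      rewrite <- (Rmult_1_l (ln 2)) at 2. apply Rmult_le_compat_r; lra. }
    destruct Hm as [Hm|Hm]; [now apply Rlt_le, exp_increasing|rewrite Hm; lra]. }
  assert (P0 := Cmod_ge_0 (Cpowr (1 - x) mu)).
  assert (Q : Cmod x ^ n <= Cmod z ^ n) by (apply pow_incr; lra).
  assert (Q0 := pow_le (Cmod x) n Hx0).
  replace B with ((1 + INR n) * Cmod z ^ n * 2 / (1 - Cmod z)) by (unfold B; field; lra).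
  unfold Rdiv. apply Rmult_le_compat.
  + apply Rmult_le_pos; [apply Rmult_le_pos; lra|lra].
  + apply Rlt_le, Rinv_0_lt_compat. lra.
  + apply Rmult_le_compat; [apply Rmult_le_pos; lra|lra| |lra].
    apply Rmult_le_compat; lra.
  + apply Rinv_le_contravar; lra.
Qed.

(** With q = sqrt |z| one has |z|^n = q^n q^n: one factor absorbs n+1, since (n+1) q^n <= 1/(1-q),
    and the other gives geometric decay. *)
Lemma binomial_sum_error (mu : R) (z : C) :
  0 < mu <= 1 -> Cmod z < 1 ->
  exists A q, 0 <= q < 1 /\ forall n,
    Cmod (binomial_sum mu n z - 1 / Cpowr (1 - z) mu) <= A * q ^ n.
Proof.
intros Hmu Hz. assert (Hr := Cmod_ge_0 z).
set (r := Cmod z) in *. set (q := sqrt r).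
assert (Hq0 : 0 <= q) by apply sqrt_pos.
assert (Hqq : q * q = r) by now apply sqrt_sqrt.
assert (Hq1 : q < 1) by nra.
assert (HP : 0 < Cmod (Cpowr (1 - z) mu)) by apply Cmod_gt_0, Cexp_neq_0.
set (P := Cmod (Cpowr (1 - z) mu)) in *.
exists (2 / (1 - r) / (1 - q) / P), q. split; [lra|]. intros n.
assert (H := binomial_sum_remainder mu n z Hmu Hz). fold r in H.
assert (HPC : Cpowr (1 - z) mu <> RtoC 0) by apply Cexp_neq_0.
replace (binomial_sum mu n z - 1 / Cpowr (1 - z) mu)%C with
  ((binomial_sum mu n z * Cpowr (1 - z) mu - 1) / Cpowr (1 - z) mu)%C
  by (field; exact HPC).
rewrite Cmod_div by exact HPC. fold P.
replace (2 / (1 - r) / (1 - q) / P * q ^ n) with (2 / (1 - r) * (q ^ n / (1 - q)) / P)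
  by (field; lra).
apply Rmult_le_compat_r; [apply Rlt_le, Rinv_0_lt_compat, HP|].
eapply Rle_trans; [exact H|].
apply Rmult_le_compat_l; [apply Rlt_le, Rdiv_lt_0_compat; lra|].
rewrite <- Hqq, Rpow_mult_distr.
apply (Rmult_le_reg_r (1 - q)); [lra|].
replace (q ^ n / (1 - q) * (1 - q)) with (q ^ n) by (field; lra).
assert (G := linear_geometric_bound q n (conj Hq0 Hq1)).
assert (Hqn := pow_le q n Hq0). assert (HqS := pow_le q (S n) Hq0).
nra.
Qed.

Lemma C_filterlim_geometric (u : nat -> C) (l : C) (A q : R) :
  0 <= q < 1 -> (forall n, Cmod (u n - l) <= A * q ^ n) ->
  filterlim u eventually (@locally C_NormedModule l).
Proof.
intros Hq Hu P [eps He].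
assert (L : is_lim_seq (fun n => A * q ^ n) 0).
{ replace (Finite 0) with (Rbar_mult A 0) by (simpl; f_equal; ring).
  apply is_lim_seq_scal_l, is_lim_seq_geom. rewrite Rabs_pos_eq; lra. }
apply is_lim_seq_spec in L. destruct (L eps) as [N HN].
exists N. intros n Hn. apply He, C_NormedModule_mixin_compat1.
specialize (HN n Hn). rewrite Rminus_0_r in HN.
eapply Rle_lt_trans; [exact (Hu n)|]. eapply Rle_lt_trans; [apply Rle_abs|exact HN].
Qed.

(** Substituting w = -Bz reduces this to the binomial series; |B| <= 1 keeps w in the unit disc. *)
Lemma v_power_series (mu B : R) :
  0 < mu <= 1 -> -1 <= B <= 1 ->
  power_series_on_disc (v mu B) (fun k => RtoC (binomial_coef mu k * (- B) ^ k)).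
Proof.
intros Hmu HB z Hz. unfold unit_disc in Hz.
set (w := (RtoC (- B) * z)%C).
assert (Hw : Cmod w < 1).
{ unfold w. rewrite Cmod_mult, Cmod_R. assert (Rabs (- B) <= 1) by (apply Rabs_le; lra).
  generalize (Cmod_ge_0 z) (Rabs_pos (- B)). nra. }
destruct (binomial_sum_error mu w Hmu Hw) as (A & q & Hq & H).
unfold v. replace (1 + B * z)%C with (1 - w)%C by (unfold w; rewrite RtoC_opp; ring).
unfold is_pseries, is_series.
apply (filterlim_ext (fun n => binomial_sum mu n w)).
- intros n. unfold binomial_sum. apply sum_n_ext. intros k.
  change (RtoC (binomial_coef mu k) * w ^ k
    = z ^ k * RtoC (binomial_coef mu k * (- B) ^ k))%C.
  unfold w. rewrite Cpow_mult_l, RtoC_mult, RtoC_pow. ring.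
- now apply (C_filterlim_geometric _ _ A q).
Qed.

Lemma partial_sum_v (mu B : R) (n : nat) (z : C) :
  0 < mu <= 1 -> -1 <= B <= 1 ->
  partial_sum n (v mu B) z = binomial_sum mu n (RtoC (- B) * z)%C.
Proof.
intros Hmu HB. rewrite (partial_sum_unique _ _ (v_power_series mu B Hmu HB)).
apply sum_n_ext. intros k.
change (RtoC (binomial_coef mu k * (- B) ^ k) * z ^ k
  = RtoC (binomial_coef mu k) * (RtoC (- B) * z) ^ k)%C.
rewrite Cpow_mult_l, RtoC_mult, RtoC_pow. ring.
Qed.

(** * The subordination *)

Lemma inv_v (nu B : R) (z : C) : (1 / v nu B z)%C = Cpowr (1 - RtoC (- B) * z) nu.
Proof.
unfold v. replace (1 + B * z)%C with (1 - RtoC (- B) * z)%C by (rewrite RtoC_opp; ring).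
assert (H : Cpowr (1 - RtoC (- B) * z) nu <> RtoC 0) by apply Cexp_neq_0.
field. exact H.
Qed.

Theorem corollary2 (mu lambda B : R)
    (hmu : 0 < mu) (hmulambda : mu <= lambda) (hlambda : lambda <= 1)
    (hB1 : -1 <= B) (hB0 : B < 0)
    (n : nat) (hn : (1 <= n)%nat) :
  subordinate (fun z : C => (partial_sum n (v mu B) z / v lambda B z)%C)
              (fun z : C => (1 / v lambda B z)%C).
Proof.
set (b := - B).
assert (Hmu1 : 0 < mu <= 1) by lra.
assert (Hb : 0 < b <= 1) by (unfold b; lra).
assert (HB : -1 <= B <= 1) by lra.
assert (Hbz : forall z, Cmod (RtoC b * z) = b * Cmod z).
{ intros z. rewrite Cmod_mult, Cmod_R, Rabs_pos_eq; lra. }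
assert (Hdisc : forall z, unit_disc z -> Cmod (RtoC b * z) < 1).
{ intros z Hz. unfold unit_disc in Hz. rewrite Hbz. generalize (Cmod_ge_0 z). nra. }
assert (Hb0 : RtoC b <> RtoC 0) by (intros E; injection E; lra).
assert (Dscal : forall z, cderiv (fun x => RtoC b * x)%C z (RtoC b * 1)%C).
{ intros z. apply cderiv_scal, cderiv_id. }
(* Dividing by v_lambda means multiplying by (1-w)^lambda, with w = bz. *)
assert (Elhs : forall z, (partial_sum n (v mu B) z / v lambda B z)%C
  = (binomial_sum mu n (RtoC b * z) * Cpowr (1 - RtoC b * z) lambda)%C).
{ intros z. rewrite partial_sum_v by assumption. unfold b. rewrite <- inv_v.
  unfold Cdiv. ring. }
assert (Dpow : forall z, unit_disc z ->
  exists l, cderiv (fun x => Cpowr (1 - RtoC b * x) lambda) z l).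
{ intros z Hz. eexists.
  apply (cderiv_comp (fun x => Cpowr (1 - x) lambda) (fun x => RtoC b * x)%C); [|apply Dscal].
  now apply cderiv_Cpowr_one_minus, Hdisc. }
split; [|split].
- intros z Hz. destruct (Dpow z Hz) as [l Hl]. eapply cderiv_ex_derive.
  apply cderiv_ext with (fun z => binomial_sum mu n (RtoC b * z) * Cpowr (1 - RtoC b * z) lambda)%C.
  { intros x. symmetry. apply Elhs. }
  apply (cderiv_mult (fun x => binomial_sum mu n (RtoC b * x))); [|exact Hl].
  apply (cderiv_comp (binomial_sum mu n) (fun x => RtoC b * x)%C); [|apply Dscal].
  now apply cderiv_binomial_sum, disc_neq_1, Hdisc.
- intros z Hz. destruct (Dpow z Hz) as [l Hl]. eapply cderiv_ex_derive.
  apply cderiv_ext with (2 := Hl). intros x. symmetry. apply inv_v.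
(* Solving 1 + B omega = F(bz) with b = -B gives omega = (1 - F(bz)) / b. *)
- exists (fun z => RtoC (/ b) * (1 - subordination_base mu lambda n (RtoC b * z)))%C.
  split; [|split; [|split]].
  + intros z Hz. eapply cderiv_ex_derive.
    apply cderiv_scal, cderiv_minus; [apply cderiv_const|].
    apply (cderiv_comp (subordination_base mu lambda n) (fun x => RtoC b * x)%C); [|apply Dscal].
    apply cderiv_subordination_base; [assumption|lra|now apply Hdisc].
  + rewrite Cmult_0_r, subordination_base_at_0. ring.
  + intros z Hz. assert (H := Cmod_one_minus_subordination_base mu lambda n _ hmu hmulambda hlambda (Hdisc z Hz)).
    rewrite Hbz in H. unfold unit_disc in Hz.
    assert (Hi : 0 < / b) by (apply Rinv_0_lt_compat; lra).
    rewrite Cmod_mult, Cmod_R, Rabs_pos_eq by lra.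
    (* The bound |1 - F(bz)| <= b |z| compensates the factor 1/b, so |omega(z)| <= |z| < 1. *)
    apply Rle_lt_trans with (/ b * (b * Cmod z)); [apply Rmult_le_compat_l; lra|].
    rewrite <- Rmult_assoc, Rinv_l, Rmult_1_l; lra.
  + intros z Hz. rewrite Elhs, inv_v. fold b.
    rewrite RtoC_inv by lra.
    (* By the choice of omega, 1 + B omega(z) is F(bz). *)
    replace (1 - RtoC b * (/ RtoC b * (1 - subordination_base mu lambda n (RtoC b * z))))%C with
      (subordination_base mu lambda n (RtoC b * z)) by (field; exact Hb0).
    symmetry. apply Cpowr_subordination_base; try assumption. now apply Hdisc.
Qed.
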